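(* Let $G$ be an amenable topological group and let $f\colon \mathcal{F}(G)\to \mathbb{R}_{\geq 0}$ be a continuous, right-invariant function satisfying Shearer's inequality. Then for every thin Følner net $(F_i)_{i\in I}$ in $G$ the limit $\lim_{i\in I} f(F_i)/|F_i|$ exists and $$\lim_{i\in I}\frac{f(F_i)}{|F_i|}=\inf_{F\in \mathcal{F}_{+}(G)}\frac{f(F)}{|F|}.$$
   Context: Topological groups are assumed Hausdorff; $\mathcal{U}(G)$ denotes the set of neighbourhoods of the neutral element of $G$. A topological group $G$ is amenable if every continuous action of $G$ on a non-empty compact Hausdorff space admits an invariant regular Borel probability measure. $\mathcal{F}(G)$ is the set of all finite subsets of $G$ and $\mathcal{F}_+(G)=\mathcal{F}(G)\setminus\{\emptyset\}$. Topology on $\mathcal{F}(G)$: for $F\in\mathcal{F}(G)$ and $U\in\mathcal{U}(G)$ let $U[F]$ be the set of all $F'\in\mathcal{F}(G)$ for which there is a bijection $\phi\colon F'\to F$ with $x\phi(x)^{-1}\in U$ for all $x\in F'$. A set $T\subseteq\mathcal{F}(G)$ is open iff for every $F\in T$ there is $U\in\mathcal{U}(G)$ with $U[F]\subseteq T$. Continuity of $f$ refers to this topology. $f$ is right-invariant if $f(Fg)=f(F)$ for all $F\in\mathcal{F}(G)$, $g\in G$. For $k\in\mathbb{N}_{>0}$, a $k$-cover of a set $F$ is a finite family $(C_i)_{i\in I}$ of subsets of $F$ such that $|\{i\in I\mid x\in C_i\}|\geq k$ for every $x\in F$. The function $f$ satisfies Shearer's inequality if for every $k\in\mathbb{N}_{>0}$,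 every $F\in\mathcal{F}(G)$ and every $k$-cover $(C_i)_{i\in I}$ of $F$ we have $f(F)\leq\frac1k\sum_{i\in I}f(C_i)$. For finite $E,F\subseteq G$ and $U\in\mathcal{U}(G)$, let $\operatorname{match}(E,F,U)$ be the maximal cardinality of a subset $M\subseteq E$ for which there is an injection $\iota\colon M\to F$ with $x\,\iota(x)^{-1}\in U$ for all $x\in M$. A net $(F_i)_{i\in I}$ of non-empty finite subsets of $G$ is a thin Følner net if for every $U\in\mathcal{U}(G)$ and every $g\in G$, $\operatorname{match}(F_i,gF_i,U)/|F_i|\to 1$. *)

(* Defs.v *)
From HB Require Import structures.
From mathcomp Require Import all_boot all_order all_algebra.
From mathcomp Require Import finmap.
From mathcomp Require Import all_classical all_reals all_analysis.

Set Implicit Arguments.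
Unset Strict Implicit.
Unset Printing Implicit Defensive.

Import Order.TTheory GRing.Theory Num.Theory.
Import numFieldNormedType.Exports.

Local Open Scope classical_set_scope.
Local Open Scope ring_scope.

HB.mixin Record isTopologicalGroup G & Group G & Topological G := {
  mulg_continuous : continuous (fun p : G * G => (p.1 * p.2)%g) ;
  invg_continuous : continuous (fun x : G => (x^-1)%g) }.

#[short(type="topologicalGroupType")]
HB.structure Definition TopologicalGroup :=
  {G of Group G & Topological G & isTopologicalGroup G}.

Section Amenability.
Context {R : realType}.

Definition borel (X : ptopologicalType) := g_sigma_algebraType (@open X).

Definition regular_measure (X : ptopologicalType) (mu : probability (borel X) R) :=
  forall A : set (borel X), measurable A ->
    mu A = ereal_inf [set mu V | V in [set V : set X | open V /\ A `<=` V]] /\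
    mu A = ereal_sup [set mu K | K in [set K : set X | compact K /\ K `<=` A]].

Definition continuous_action (G : topologicalGroupType) (X : topologicalType)
    (act : G -> X -> X) :=
  [/\ forall x, act 1%g x = x,
      forall g h x, act (g * h)%g x = act g (act h x) &
      continuous (fun p : G * X => act p.1 p.2)].

Definition invariant_measure (G : topologicalGroupType) (X : ptopologicalType)
    (act : G -> X -> X) (mu : probability (borel X) R) :=
  forall (g : G) (A : set (borel X)), measurable A ->
    mu (act g @^-1` A) = mu A.

End Amenability.

(* The sigma-algebra types of the library carry a base point, so non-emptiness
   of X is expressed by taking X to be a pointed topological space. *)
Definition amenable (R : realType) (G : topologicalGroupType) :=
  forall (X : ptopologicalType) (act : G -> X -> X),
    compact [set: X] -> hausdorff_space X -> continuous_action act ->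
    exists mu : probability (borel X) R, regular_measure mu /\ invariant_measure act mu.

(* Alias of {fset G} carrying the topology below. *)
Definition finsets (G : choiceType) := {fset G}.
HB.instance Definition _ (G : choiceType) := Choice.on (finsets G).

Section FiniteSubsets.
Context {G : topologicalGroupType}.
Implicit Types (E F : finsets G) (U : set G).

(* Here and in matchable, a map between finite subsets is a total function on G
   of which only the restriction matters. *)
Definition fset_ball U F : set (finsets G) :=
  [set F' | exists2 phi : G -> G, set_bij [set` F'] [set` F] phi &
            forall x, x \in F' -> U (x * (phi x)^-1)%g].

Definition finsets_open : set_system (finsets G) :=
  [set T | forall F, T F -> exists2 U, nbhs (1%g : G) U & fset_ball U F `<=` T].

Lemma fset_ballS U V F : U `<=` V -> fset_ball U F `<=` fset_ball V F.
Proof. by move=> UV F' [phi bphi Uphi]; exists phi => // x /Uphi /UV. Qed.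

Lemma finsets_openT : finsets_open setT.
Proof. by move=> F _; exists setT => //; exact: filterT. Qed.

Lemma finsets_openI (S T : set (finsets G)) :
  finsets_open S -> finsets_open T -> finsets_open (S `&` T).
Proof.
move=> oS oT F [/oS[U nU US] /oT[V nV VT]].
exists (U `&` V); first exact: filterI.
by move=> F' UVF'; split; [apply: US|apply: VT]; apply: fset_ballS UVF' => x [].
Qed.

Lemma finsets_open_bigU (I : Type) (T : I -> set (finsets G)) :
  (forall i, finsets_open (T i)) -> finsets_open (\bigcup_i T i).
Proof.
move=> oT F [i _ /oT[U nU UT]]; exists U => // F' /UT TF'.
by exists i.
Qed.

HB.instance Definition _ := isOpenTopological.Build (finsets G)
  finsets_openT finsets_openI finsets_open_bigU.

Definition ltrans (g : G) F : finsets G := [fset (g * x)%g | x in F]%fset.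
Definition rtrans F (g : G) : finsets G := [fset (x * g)%g | x in F]%fset.

Definition matchable U (M F : finsets G) :=
  exists2 iota : G -> G, {in M &, injective iota} &
    forall x, x \in M -> iota x \in F /\ U (x * (iota x)^-1)%g.

Definition match_card E F U : nat :=
  (\max_(M <- fpowerset E | `[< matchable U M F >]) #|` M|)%N.

End FiniteSubsets.

Definition right_invariant (R : realType) (G : topologicalGroupType)
    (f : finsets G -> R) :=
  forall F g, f (rtrans F g) = f F.

Definition kcover (T : choiceType) (k : nat) (F : {fset T}) (I : finType)
    (C : I -> {fset T}) :=
  (forall i, C i `<=` F)%fset /\
  (forall x, x \in F -> (k <= #|[pred i | x \in C i]|)%N).

Definition shearer (R : realType) (G : choiceType) (f : finsets G -> R) :=
  forall (k : nat) (F : finsets G) (I : finType) (C : I -> finsets G),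
    (0 < k)%N -> kcover k F C -> f F <= k%:R^-1 * \sum_(i : I) f (C i).

Definition directed (I : Type) (le : I -> I -> Prop) :=
  [/\ inhabited I, forall i, le i i,
      forall i j k, le i j -> le j k -> le i k &
      forall i j, exists2 k, le i k & le j k].

(* Convergence of a net indexed by I is convergence along this filter. *)
Definition tails (I : Type) (le : I -> I -> Prop) : set_system I :=
  filter_from setT (fun i => [set j | le i j]).

Lemma tails_filter (I : Type) (le : I -> I -> Prop) :
  directed le -> ProperFilter (tails le).
Proof.
move=> [[i0] lexx le_trans dir]; apply: filter_from_proper.
  apply: filter_fromT_filter; first by exists i0.
  move=> i j; have [k ik jk] := dir i j; exists k => l /= kl.
  by split; [apply: le_trans ik kl|apply: le_trans jk kl].
by move=> i _; exists i; exact: lexx.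
Qed.

Definition thin_Folner_net (R : realType) (G : topologicalGroupType) (I : Type)
    (le : I -> I -> Prop) (F : I -> finsets G) :=
  [/\ directed le, forall i, F i != fset0 &
      forall (U : set G) (g : G), nbhs (1%g : G) U ->
        ((match_card (F i) (ltrans g (F i)) U)%:R / #|` F i|%:R : R)
          @[i --> tails le] --> (1 : R)].

(* Main.v *)
(** Shearer's inequality with [k = 1] and the cover by singletons bounds [f] on
    few points by their number times [f {1}].  Fix a non-empty finite [E] and a
    neighbourhood [U] of 1 so small that the sets [U e], [e] in [E], are disjoint.
    For [F] far out in the Folner net, a maximal matching of [F] with [e F] sends
    almost every [x] in [F] to some [e y] with [x] in [U e y], [y] in [F].  For
    fixed [y], the set of the points [x] obtained as [e] runs over [E] is, for
    most [y], a [U]-perturbation of [E y], so [f] takes a value close to [f E] on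
    it by continuity and right invariance.  These sets, one for each such [y],
    cover all but few points of [F] at least [#|E|] times, whence
    [f F / #|F| <= f E / #|E| + eps]. *)
Require Import Defs.
From HB Require Import structures.
From mathcomp Require Import all_boot all_order all_algebra.
From mathcomp Require Import finmap.
From mathcomp Require Import all_classical all_reals all_analysis.
From mathcomp Require Import lra.

Set Implicit Arguments.
Unset Strict Implicit.
Unset Printing Implicit Defensive.

Import Order.TTheory GRing.Theory Num.Theory.
Import numFieldNormedType.Exports.

Local Open Scope classical_set_scope.
Local Open Scope ring_scope.

Lemma card_bigfcup_le (I T : choiceType) (A : {fset I}) (S : I -> {fset T}) :
  (#|` \bigcup_(i <- A) S i| <= \sum_(i <- A) #|` S i|)%fset%N.
Proof.
apply: (big_ind2 (fun (X : {fset T}) n => #|` X| <= n)%N) => //.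
move=> X m Y n Xm Yn.
by apply: leq_trans (leq_card_fsetU _ _) _; exact: leq_add.
Qed.

(** * Shearer's inequality with exceptional points *)

Section CoverWithExceptions.
Variables (R : realType) (G : choiceType) (f : finsets G -> R).
Hypotheses (f_shearer : shearer f).

(** Shearer's inequality is applied to the sets [C j] together with [k] copies of each singleton in
    [B]. The copies add at most [k] times [a] per point of [B], and the division by [k] leaves
    [a]. *)
Lemma shearer_exceptions (K : choiceType) (k : nat) (F B : {fset G})
    (J : {fset K}) (C : K -> {fset G}) (c a : R) :
  (0 < k)%N -> (B `<=` F)%fset ->
  (forall j, j \in J -> (C j `<=` F)%fset /\ f (C j) <= c) ->
  (forall x, f [fset x]%fset <= a) ->
  (forall x, x \in F -> x \notin B ->
     (k <= #|` [fset j in J | x \in C j]%fset|)%N) ->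
  f F <= #|` J|%:R * c / k%:R + #|` B|%:R * a.
Proof.
move=> k0 BF CF fa cov.
pose D (i : J + 'I_k * B) : finsets G :=
  match i with inl j => C (val j) | inr p => [fset val p.2]%fset end.
have DF : kcover k F D.
  split=> [[j|[? x]]|x xF]; first by have [] := CF _ (valP j).
    by rewrite /D fsub1set; apply: (fsubsetP BF); exact: valP.
  have [xB|xB] := boolP (x \in B).
    pose h (m : 'I_k) : J + 'I_k * B := inr (m, [` xB]%fset).
    have hinj : injective h by move=> m m' [].
    rewrite -[leqLHS](card_ord k) -(card_codom hinj).
    apply/subset_leq_card/fintype.subsetP => _ /codomP[m ->].
    by rewrite inE /= inE.
  apply: leq_trans (cov _ xF xB) _.
  pose S := [pred j : J | x \in C (val j)].
  have -> : #|` [fset j in J | x \in C j]%fset| = #|S|.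
    transitivity #|` [fset val j | j in S]%fset|; last first.
      by rewrite card_imfset ?cardE//; exact: val_inj.
    congr (size (enum_fset _)); apply/fsetP => j; apply/idP/imfsetP => [|[u]].
      by rewrite !inE => /andP[jJ xj]; exists [` jJ]%fset; rewrite ?inE.
    by rewrite !inE => xu ->; rewrite xu andbT; exact: valP.
  have linj : injective (@inl J ('I_k * B)%type) by move=> j j' [].
  rewrite -(fintype.card_image linj).
  by apply/subset_leq_card/fintype.subsetP => _ /fintype.imageP[j xj ->]; exact: xj.
have k0R : 0 < k%:R :> R by rewrite ltr0n.
apply: le_trans (f_shearer k0 DF) _.
rewrite mulrC ler_pdivrMr// mulrDl divfK ?gt_eqF//.
rewrite big_sumType/=; apply: lerD.
  rewrite cardfE mulr_natl -sumr_const; apply: ler_sum => j _.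
  by have [] := CF _ (valP j).
apply: (@le_trans _ _ (\sum_(i : 'I_k * B) a)).
  by apply: ler_sum => i _; exact: fa.
by rewrite sumr_const card_prod card_ord -cardfE
  -[leLHS]mulr_natl natrM [k%:R * _]mulrC mulrAC.
Qed.

End CoverWithExceptions.

(** * Counting for a finite family of partial injections *)

Section PartialInjections.
Variables (I T : choiceType) (E : {fset I}) (F : {fset T}).
Variables (M : I -> {fset T}) (psi : I -> T -> T).
Hypothesis MF : forall i, i \in E -> (M i `<=` F)%fset.
Hypothesis psiF : forall i x, i \in E -> x \in M i -> psi i x \in F.
Hypothesis psi_inj : forall i, i \in E -> {in M i &, injective (psi i)}.

(** In the application [psi e] sends [x] to the [y] for which [x] is matched with [e y]. *)
Definition fiber (y : T) : {fset T} :=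
  [fset x in F | has (fun i => (x \in M i) && (psi i x == y)) E]%fset.

Definition full_points : {fset T} :=
  [fset y in F | all (fun i => y \in (psi i @` M i)%fset) E]%fset.

Definition exceptional_points : {fset T} :=
  [fset x in F | ~~ all (fun i => (x \in M i) && (psi i x \in full_points)) E]%fset.

(** A point of [F] that is not full is missed by some [psi i], and the injection [psi i] misses as
    many points of [F] as [M i] does. *)
Lemma card_full_points_defect :
  (#|` F `\` full_points| <= \sum_(i <- E) #|` F `\` M i|)%fset%N.
Proof.
have sub : (F `\` full_points `<=`
    \bigcup_(i <- E) (F `\` [fset psi i x | x in M i]))%fset.
  apply/fsubsetP => y; rewrite !inE => /andP[+ yF]; rewrite yF/=.
  case/allPn => i iE yi; apply/bigfcupP; exists i; first by rewrite iE.
  by rewrite inE yi.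
apply: leq_trans (fsubset_leq_card sub) _.
apply: leq_trans (card_bigfcup_le _ _) _.
rewrite big_seq [leqRHS]big_seq; apply: leq_sum => i iE.
rewrite !cardfsDS ?MF//; last first.
  by apply/fsubsetP => _ /imfsetP[x xM ->]; exact: psiF.
by rewrite card_in_imfset//; exact: psi_inj.
Qed.

(** Exceptional points outside some [M i] account for one copy of the sum. The others are sent by
    some [psi i] to a point that is not full; for each [i] in [E], injectivity bounds their number
    by the previous lemma. *)
Lemma card_exceptional_points :
  (#|` exceptional_points|
     <= (#|` E|).+1 * \sum_(i <- E) #|` F `\` M i|)%fset%N.
Proof.
pose S i := [fset x in M i | psi i x \in (F `\` full_points)%fset]%fset.
have sub : (exceptional_points `<=`
    (\bigcup_(i <- E) (F `\` M i)) `|` \bigcup_(i <- E) S i)%fset.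
  apply/fsubsetP => x; rewrite !inE/= => /andP[xF /allPn[i iE]].
  have [xM/= nx|xM _] := boolP (x \in M i); apply/orP; [right|left];
    apply/bigfcupP; exists i; rewrite ?iE//.
    rewrite in_fset inE/= xM/= in_fsetD nx/=; exact: psiF.
  by rewrite inE xM.
apply: leq_trans (fsubset_leq_card sub) _.
apply: leq_trans (leq_card_fsetU _ _) _.
rewrite mulSn; apply: leq_add; first exact: card_bigfcup_le.
apply: leq_trans (card_bigfcup_le _ _) _.
rewrite [X in (X * _)%N]card_fset_sum1 big_distrl/= big_seq [leqRHS]big_seq.
apply: leq_sum => i iE; rewrite mul1n.
apply: leq_trans card_full_points_defect.
have <- : #|` [fset psi i x | x in S i]%fset| = #|` S i|.
  apply: card_in_imfset => x y /=; rewrite !in_fset !inE.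
  by move=> /andP[xM _] /andP[yM _]; exact: psi_inj.
apply: fsubset_leq_card; apply/fsubsetP => _ /imfsetP[x xS ->].
by move: xS; rewrite /S !inE/= => /andP[_ ->].
Qed.

(** Such an [x] lies in the fiber over the full point [psi i x] for every [i] in [E], and these
    points are distinct by the first hypothesis. *)
Lemma fiber_covers x :
  {in E &, forall i j, x \in M i -> x \in M j -> psi i x = psi j x -> i = j} ->
  x \in F -> x \notin exceptional_points ->
  (#|` E| <= #|` [fset y in full_points | x \in fiber y]|)%fset%N.
Proof.
move=> inj xF; rewrite !inE xF/= negbK => /allP xE.
have <- : #|` [fset psi i x | i in E]%fset| = #|` E|.
  apply: card_in_imfset => i j /= iE jE.
  by apply: inj => //; [have /andP[] := xE _ iE|have /andP[] := xE _ jE].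
apply: fsubset_leq_card; apply/fsubsetP => _ /imfsetP[i /= iE ->].
have /andP[xM xfull] := xE _ iE.
rewrite in_fset inE/= xfull/= !inE/= xF/=.
by apply/hasP; exists i => //; rewrite xM eqxx.
Qed.

End PartialInjections.

(** * Matchings and separating neighbourhoods in a topological group *)

Section Matchings.
Variable G : topologicalGroupType.
Implicit Types (E F M : finsets G) (U : set G).

Lemma match_card_attained E F U :
  exists M : finsets G, [/\ (M `<=` E)%fset, matchable U M F &
    #|` M| = match_card E F U].
Proof.
rewrite /match_card big_seq_cond.
apply: (big_ind (fun n => exists M : finsets G,
    [/\ (M `<=` E)%fset, matchable U M F & #|` M| = n])).
(* The empty matching attains 0, the initial value of the maximum. *)
- exists fset0; split; rewrite ?cardfs0//.
  by exists id => [x y|x]; rewrite in_fset0.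
- by move=> m n hm hn; rewrite /maxn; case: ifP.
- move=> M /andP[]; rewrite fpowersetE => ME /asboolP UM.
  by exists M.
Qed.

(** This is pairwise disjointness of the translates [U e], for [e] in [E]. *)
Definition separates U E := {in E &, forall e e' : G, forall x : G,
  U (x * e^-1)%g -> U (x * e'^-1)%g -> e = e'}.

Lemma nbhs1_mulr (e : G) (A : set G) : nbhs e A ->
  nbhs (1%g : G) [set u : G | A (u * e)%g].
Proof.
move=> eA.
have /= := @mulg_continuous G (1%g, e) A.
rewrite mul1g => /(_ eA)[[P Q]/= [nP nQ] PQ].
apply: filterS nP => u Pu; apply: (PQ (u, e)); split => //=.
exact: nbhs_singleton.
Qed.

(** Disjoint neighbourhoods of [e] and [e'] are translated back to 1 and intersected; only finitely
    many pairs occur. *)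
Lemma ex_separating_nbhs E : hausdorff_space G ->
  exists2 U, nbhs (1%g : G) U & separates U E.
Proof.
rewrite open_hausdorff => hausG.
have pair (p : G * G) : exists2 U, nbhs (1%g : G) U &
    forall x, U (x * p.1^-1)%g -> U (x * p.2^-1)%g -> p.1 = p.2.
  case: p => e e' /=; have [<-|ne] := eqVneq e e'; first by exists setT; first exact: filterT.
  have [[A B]/= [eA eB] [oA oB AB0]] := hausG _ _ ne.
  exists ([set u : G | A (u * e)%g] `&` [set u | B (u * e')%g]).
    by apply: filterI; apply: nbhs1_mulr; apply: open_nbhs_nbhs; split => //; exact: set_mem.
  move=> x [+ _] [_]; rewrite /= !mulgVK => Ax Bx.
  by have : (A `&` B) x by []; rewrite (eqP AB0).
pose V p := sval (cid2 (pair p)).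
have V1 p : nbhs (1%g : G) (V p) by rewrite /V; case: cid2.
have VP p x : V p (x * p.1^-1)%g -> V p (x * p.2^-1)%g -> p.1 = p.2.
  by rewrite /V; case: cid2 => U _ /=; exact.
exists (\bigcap_(p in [set` (E `*` E)%fset]) V p).
  by apply: filter_bigI.
move=> e e' eE e'E x Ux Ux'.
apply: (VP (e, e') x); [apply: Ux|apply: Ux']; rewrite /= in_fsetM/=;
  exact/andP.
Qed.

Lemma ltransP (g : G) F y : y \in ltrans g F -> (g^-1 * y)%g \in F.
Proof. by move=> /imfsetP[x /= xF ->]; rewrite mulKg. Qed.

(* [U (x * (e * y)^-1)] says that [x] lies in [U e y], so a point [x] that
   [psi e] sends to [y] has [x * y^-1] close to [e]. *)
Lemma rtrans_fiber_ball E F U (psi : G -> G -> G) (D : G -> finsets G) y :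
  separates U E ->
  (forall e, e \in E -> (D e `<=` F)%fset) ->
  (forall e, e \in E -> {in D e &, injective (psi e)}) ->
  (forall e x, e \in E -> x \in D e -> U (x * (e * psi e x)^-1)%g) ->
  y \in full_points E F D psi ->
  fset_ball U E (rtrans (fiber E F D psi y) y^-1%g).
Proof.
move=> Usep DF psi_inj Upsi; rewrite !inE/= => /andP[yF /allP yfull].
set A := rtrans _ _.
have AP z : z \in A -> exists e, [/\ e \in E, (z * y)%g \in D e,
    psi e (z * y)%g = y & U (z * e^-1)%g].
  case/imfsetP => x /=; rewrite !inE/= => /andP[xF /hasP[e eE /andP[xD /eqP xy]]] ->.
  exists e; rewrite mulgVK; split => //.
  by have := Upsi _ _ eE xD; rewrite xy invgM mulgA.
have /choice[phi phiP] z : exists e, z \in A -> [/\ e \in E, (z * y)%g \in D e,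
    psi e (z * y)%g = y & U (z * e^-1)%g].
  have [/AP[e eP]|_] := boolP (z \in A); first by exists e.
  by exists 1%g.
exists phi; last by move=> x /phiP[].
split.
- by move=> z /= /phiP[].
- move=> z z' /[!inE] zA z'A zz'.
  have [eE zD zy _] := phiP _ zA; have [_ z'D z'y _] := phiP _ z'A.
  apply: (mulIg y); apply: (psi_inj _ eE) => //; first by rewrite zz'.
  by rewrite zy zz' z'y.
- move=> e /= eE.
  have /imfsetP[x /= xD xy] := yfull _ eE.
  have Uxe : U (x * y^-1 * e^-1)%g.
    by have := Upsi _ _ eE xD; rewrite -xy invgM mulgA.
  have xyA : (x * y^-1)%g \in A.
    apply/imfsetP; exists x => //=; rewrite !inE/= (fsubsetP (DF _ eE))//=.
    by apply/hasP; exists e => //; rewrite xD -xy eqxx.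
  exists (x * y^-1)%g => //=.
  (* The element chosen by [phi] is a priori not [e], but [x * y^-1] lies in both translates of [U],
     so separation identifies them. *)
  by have [? _ _ ?] := phiP _ xyA; apply: Usep; last exact: Uxe.
Qed.

End Matchings.

(** * Bounds for the ratio along a thin Folner net *)

Section ShearerOnGroups.
Variables (R : realType) (G : topologicalGroupType) (f : finsets G -> R).
Hypotheses (f_ge0 : forall F, 0 <= f F) (f_inv : right_invariant f).
Hypothesis f_shearer : shearer f.
Implicit Types (E F M : finsets G) (U : set G).

(** The fibers over full points cover each non-exceptional point of [F] at least as often as [E] has
    elements. *)
Lemma shearer_matching_bound E F U (D : G -> finsets G) (c : R) :
  E != fset0 -> separates U E -> 0 <= c ->
  (forall A, fset_ball U E A -> f A <= c) ->
  (forall e, e \in E -> (D e `<=` F)%fset /\ matchable U (D e) (ltrans e F)) ->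
  f F <= #|` F|%:R * c / #|` E|%:R
         + ((#|` E|).+1 * \sum_(e <- E) #|` F `\` D e|)%fset%:R * f [fset 1%g]%fset.
Proof.
move=> E0 Usep c0 fc DF.
have /choice[iota iotaP] e : exists i : G -> G, e \in E ->
    {in D e &, injective i} /\
    forall x, x \in D e -> i x \in ltrans e F /\ U (x * (i x)^-1)%g.
  have [/DF[_ [i ? ?]]|_] := boolP (e \in E); first by exists i.
  by exists id.
(* A match with [e y] is recorded as [y], which brings the values back into [F]. *)
pose psi e x := (e^-1 * iota e x)%g.
have DF1 e : e \in E -> (D e `<=` F)%fset by move=> /DF[].
have psiF e x : e \in E -> x \in D e -> psi e x \in F.
  by move=> /iotaP[_ iP] /iP[iF _]; exact: ltransP.
have psi_inj e : e \in E -> {in D e &, injective (psi e)}.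
  by move=> /iotaP[iI _] x x' xD x'D /mulgI; exact: iI.
have Upsi e x : e \in E -> x \in D e -> U (x * (e * psi e x)^-1)%g.
  by move=> /iotaP[_ iP] /iP[_]; rewrite /psi mulVKg.
apply: (@le_trans _ _ (#|` full_points E F D psi|%:R * c / #|` E|%:R
    + #|` exceptional_points E F D psi|%:R * f [fset 1%g]%fset)).
  apply: (shearer_exceptions f_shearer (C := fiber E F D psi)).
  - by rewrite cardfs_gt0.
  - by apply/fsubsetP => x; rewrite !inE => /andP[].
  - move=> y yfull; split; first by apply/fsubsetP => x; rewrite !inE => /andP[].
    (* Translation by [y^-1] preserves [f] and moves the fiber into the [U]-ball around [E]. *)
    by rewrite -(f_inv _ y^-1%g); apply/fc/rtrans_fiber_ball.
  - move=> x; rewrite -(f_inv [fset 1%g]%fset x) /rtrans.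
    by rewrite imfset_fset1 mul1g.
  - move=> x xF xB; apply: fiber_covers => // e e' eE e'E xe xe' ee'.
    (* With [y] the common image, [x * y^-1] lies in both [U e] and [U e']. *)
    apply: (Usep _ _ eE e'E (x * (psi e x)^-1)%g).
      by have := Upsi _ _ eE xe; rewrite invgM mulgA.
    by have := Upsi _ _ e'E xe'; rewrite -ee' invgM mulgA.
apply: lerD.
  rewrite ler_wpM2r ?invr_ge0// ler_wpM2r// ler_nat; apply: fsubset_leq_card.
  by apply/fsubsetP => x; rewrite !inE => /andP[].
by rewrite ler_wpM2r// ler_nat; exact: card_exceptional_points.
Qed.

Lemma almost_full_matching (delta : R) F (g : G) U : F != fset0 ->
  1 - delta < (match_card F (ltrans g F) U)%:R / #|` F|%:R ->
  exists M, [/\ (M `<=` F)%fset, matchable U M (ltrans g F) &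
    #|` F `\` M|%fset%:R <= delta * #|` F|%:R].
Proof.
move=> F0; have [M [MF UM <-]] := match_card_attained F (ltrans g F) U.
have F0R : 0 < #|` F|%:R :> R by rewrite ltr0n cardfs_gt0.
rewrite ltr_pdivlMr// => lt; exists M; split => //.
rewrite cardfsDS// natrB ?fsubset_leq_card//; lra.
Qed.

Lemma Folner_ratio_near (I : Type) (le : I -> I -> Prop) (F : I -> finsets G)
    E (eps : R) :
  hausdorff_space G -> continuous f -> thin_Folner_net R le F ->
  E != fset0 -> 0 < eps ->
  \forall i \near tails le, f (F i) / #|` F i|%:R <= f E / #|` E|%:R + eps.
Proof.
move=> hausG f_cont [dirle F0 FF] E0 eps0.
have PF := tails_filter dirle.
set n := #|` E|; set a := f [fset 1%g]%fset.
have n0 : 0 < n%:R :> R by rewrite ltr0n cardfs_gt0.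
have a0 : 0 <= a by exact: f_ge0.
(* The margin becomes [eps / 2] after division by [n]. *)
pose c := f E + n%:R * (eps / 2).
have [U1 U1n U1c] : exists2 U, nbhs (1%g : G) U &
    forall A, fset_ball U E A -> f A <= c.
  have /cvgr_le/(_ c) := f_cont E; rewrite ltrDl mulr_gt0 ?divr_gt0//.
  move=> /(_ isT)[B [oB BE] Bc]; have [U nU UB] := oB _ BE.
  by exists U => // A /UB /Bc.
have [U2 U2n U2sep] := ex_separating_nbhs E hausG.
pose U := U1 `&` U2.
have Un : nbhs (1%g : G) U by exact: filterI.
(* This makes the exceptional term at most [eps / 2] per point of [F i]; [a + 1] avoids division by
   zero when [a] is 0. *)
pose delta := eps / 2 / (n.+1%:R * n%:R * (a + 1)).
have den0 : 0 < n.+1%:R * n%:R * (a + 1) by rewrite !mulr_gt0// ltr_wpDl.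
have delta0 : 0 < delta by rewrite !divr_gt0.
have small : n.+1%:R * (n%:R * delta) * a <= eps / 2.
  apply: (@le_trans _ _ (n.+1%:R * (n%:R * delta) * (a + 1))).
    apply: ler_wpM2l; rewrite ?lerDl//.
    by apply: mulr_ge0 => //; apply: mulr_ge0 => //; exact: ltW.
  have -> : n.+1%:R * (n%:R * delta) * (a + 1)
      = n.+1%:R * n%:R * (a + 1) * delta
    by rewrite mulrA mulrAC.
  by rewrite mulrC divfK// gt_eqF.
near=> i.
have Fi0 : 0 < #|` F i|%:R :> R by rewrite ltr0n cardfs_gt0.
have /choice[D DP] e : exists M : finsets G, e \in E ->
    [/\ (M `<=` F i)%fset, matchable U M (ltrans e (F i)) &
    #|` F i `\` M|%fset%:R <= delta * #|` F i|%:R].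
  have [eE|_] := boolP (e \in E); last by exists fset0.
  have [|M MP] := @almost_full_matching delta (F i) e U (F0 i); last by exists M.
  (* As [E] is finite, the matching conditions for all its elements hold together far out in the
     net. *)
  move: e eE; near: i.
  apply: (@filter_bigI _ _ E (fun e => [set i | 1 - delta <
    (match_card (F i) (ltrans e (F i)) U)%:R / #|` F i|%:R])) => e eE.
  have /cvgr_gt/(_ (1 - delta)) := FF U e Un.
  by apply; rewrite ltrBlDr ltrDl.
have c0 : 0 <= c by rewrite addr_ge0 ?f_ge0// mulr_ge0// divr_ge0// ltW.
have Usep : separates U E.
  by move=> e e' eE e'E x [_ ?] [_ ?]; exact: (U2sep e e' eE e'E x).
have fc A : fset_ball U E A -> f A <= c.
  by move=> EA; apply: U1c; apply: fset_ballS EA => x [].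
have := shearer_matching_bound E0 Usep c0 fc (F := F i) (D := D).
move=> /(_ (fun e eE => let: And3 p q _ := DP e eE in conj p q)).
rewrite ler_pdivrMr// => /le_trans; apply.
rewrite -/n -/a.
have sumD : (\sum_(e <- E) #|` F i `\` D e|)%fset%:R <= n%:R * (delta * #|` F i|%:R) :> R.
  rewrite natr_sum.
  apply: (@le_trans _ _ (\sum_(e <- E) delta * #|` F i|%:R)).
    by rewrite big_seq [leRHS]big_seq; apply: ler_sum => e /DP[].
  by rewrite big_const_seq count_predT iter_addr_0 mulr_natl.
have -> : #|` F i|%:R * c / n%:R = #|` F i|%:R * (f E / n%:R + eps / 2).
  by rewrite /c -mulrA mulrDl; congr (_ * (_ + _)); rewrite mulrC mulKf ?gt_eqF.
rewrite natrM.
have : n.+1%:R * (n%:R * (delta * #|` F i|%:R)) * a <= eps / 2 * #|` F i|%:R.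
  have -> : n.+1%:R * (n%:R * (delta * #|` F i|%:R)) * a
      = n.+1%:R * (n%:R * delta) * a * #|` F i|%:R
    by rewrite !mulrA mulrAC.
  by rewrite ler_wpM2r// ltW.
have := ler_wpM2r a0 (ler_wpM2l (ler0n R n.+1) sumD).
lra.
Unshelve. all: by end_near. Qed.

End ShearerOnGroups.

(** Every ratio is at least the infimum. Conversely, some [E] has ratio within [eps / 2] of it, and
    far out in the net the ratio of [F i] exceeds that of [E] by at most another [eps / 2]. *)
Theorem theorem3p4 (R : realType) (G : topologicalGroupType)
    (hausG : hausdorff_space G) (amenG : amenable R G)
    (f : finsets G -> R) (f_ge0 : forall F, 0 <= f F)
    (f_cont : continuous f) (f_inv : right_invariant f) (f_shearer : shearer f)
    (I : Type) (le : I -> I -> Prop) (F : I -> finsets G)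
    (F_Folner : thin_Folner_net R le F) :
  (f (F i) / #|` F i|%:R) @[i --> tails le] -->
    inf [set f E / #|` E|%:R | E in [set E : finsets G | E != fset0]].
Proof.
set S := (X in inf X).
(* [inf] is a genuine infimum only for a non-empty set bounded below. *)
have lb : has_lbound S.
  by exists 0 => _ [E _ <-]; rewrite divr_ge0.
have ne : S !=set0.
  exists (f [fset 1%g]%fset / #|` [fset (1 : G)%g]%fset|%:R).
  by exists [fset 1%g]%fset => //=; rewrite -cardfs_gt0 cardfs1.
have [dirle F0 _] := F_Folner.
have PF := tails_filter dirle.
apply/cvgrPdist_lt => eps eps0.
have eps2 : 0 < eps / 2 by rewrite divr_gt0.
have [_ [E E0 <-] Elt] := inf_adherent eps2 (conj ne lb).
near=> i.
have Fge : inf S <= f (F i) / #|` F i|%:R.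
  by apply: ge_inf => //; exists (F i) => //=.
rewrite distrC ger0_norm ?subr_ge0//.
suff : f (F i) / #|` F i|%:R <= f E / #|` E|%:R + eps / 2 by lra.
near: i; exact: Folner_ratio_near.
Unshelve. all: by end_near. Qed.
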